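(* For any positive integer $r$, any positive integer $n\ge 2$, and any spherical $r$-coloring of $\mathbb{E}^n$, there is a monochromatic copy of $\ell_3$ or a rainbow copy of $\ell_3$.
   Context: $\mathbb{E}^n$ denotes $n$-dimensional Euclidean space. An $r$-coloring of $\mathbb{E}^n$ is an assignment to each point of one of $r$ colors (not all colors need be used). An $r$-coloring of $\mathbb{E}^n$ is spherical if all points at the same distance from the origin receive the same color. $\ell_m$ denotes the set consisting of $m$ points on a line with consecutive points at distance one; a copy of $\ell_3$ is a set congruent to $\ell_3$. A set of points is monochromatic if all its points have the same color, and rainbow if its points have pairwise distinct colors. *)

(* Defs.v *)
From HB Require Import structures.
From mathcomp Require Import all_boot all_order all_algebra.
From mathcomp Require Import boolp classical_sets functions reals.

Set Implicit Arguments.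
Unset Strict Implicit.
Unset Printing Implicit Defensive.

Import Order.TTheory GRing.Theory Num.Theory.
Local Open Scope classical_set_scope.
Local Open Scope ring_scope.

(* E^n is 'rV[R]_n with this distance; the norm `|_| that MathComp-Analysis
   puts on matrices is the sup norm, hence not usable here. *)
Definition edist (R : realType) (n : nat) (x y : 'rV[R]_n) : R :=
  Num.sqrt (\sum_(i < n) (x ord0 i - y ord0 i) ^+ 2).

(* The two sets may live in spaces of different dimensions. Injectivity of f
   on A follows from the preservation of distances. *)
Definition congruent (R : realType) (k n : nat)
    (A : set 'rV[R]_k) (B : set 'rV[R]_n) : Prop :=
  exists f : 'rV[R]_k -> 'rV[R]_n,
    f @` A = B /\
    (forall x y, A x -> A y -> edist (f x) (f y) = edist x y).

(* The points 0, 1, ..., m - 1 of the line E^1. *)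
Definition ell (R : realType) (m : nat) : set 'rV[R]_1 :=
  [set const_mx (i%:R : R) | i in [set i : nat | (i < m)%N]].

Definition spherical (R : realType) (n r : nat) (c : 'rV[R]_n -> 'I_r) : Prop :=
  forall x y : 'rV[R]_n, edist x 0 = edist y 0 -> c x = c y.

Definition monochromatic (R : realType) (n r : nat) (c : 'rV[R]_n -> 'I_r)
    (S : set 'rV[R]_n) : Prop :=
  forall x y : 'rV[R]_n, S x -> S y -> c x = c y.

Definition rainbow (R : realType) (n r : nat) (c : 'rV[R]_n -> 'I_r)
    (S : set 'rV[R]_n) : Prop :=
  forall x y : 'rV[R]_n, S x -> S y -> x <> y -> c x <> c y.

(* Main.v *)
Require Import Defs.
From HB Require Import structures.
From mathcomp Require Import all_boot all_order all_algebra.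
From mathcomp Require Import boolp classical_sets functions reals.
From mathcomp Require Import ring lra.

(** A spherical coloring is a coloring [g] of the squared norms.  The parallelogram
    law turns a copy of [ell 3] with middle point [p] and unit direction [u] into
    three squared norms [a, b, d] with [a + d = 2 b + 2]; conversely, in dimension
    at least two every such triple with [0 < b] and [(a - d)^2 <= 16 b] comes from
    a copy, because [u] can be turned so that the inner product of [p] and [u] is any number
    of absolute value at most [|p|] (lemma [ell3_with_norms]).  So if the theorem
    failed, each of these triples would show exactly two colors.

    Such a [g] does not exist, whatever the number of colors.  The triples
    [(b + 1, b, b + 1)] and [(b, b, b + 2)] make [g] injective on
    [{b, b + 1, b + 2}] for [b >= 1].  If moreover [g b <> g (b + 3)], then the four values
    at [b, ..., b + 3] are distinct, and [g (b + 1/2)] must lie both in the pair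
    [{g b, g (b + 3)}] and in the pair [{g (b + 1), g (b + 2)}]; hence [g] has
    period 3 from 1 on (lemma [period3]).

    The homomorphisms [phi] to Z/3 with [phi 1 = 1] satisfy all these constraints:
    [phi a + phi b + phi d = 3 phi b + 2 = 2], whereas three equal or three distinct
    elements of Z/3 have sum 0.  But they do not extend to a group in which 1 is
    divisible by 3; so the contradiction is found among thirds of integers.  Modulo 3, the cosets [x + Z], [x + 1/3 + Z]
    and [x + 2/3 + Z] carry three colors each.  If one point is taken in each coset,
    then after shifts by multiples of 3 one of the three points is the middle of a
    triple formed by them: which one it is depends on the sum of the integer parts
    modulo 3.  Thus no choice is rainbow, whereas three colors per coset allow
    a rainbow choice. *)

Set Implicit Arguments.
Unset Strict Implicit.
Unset Printing Implicit Defensive.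

Import Order.TTheory GRing.Theory Num.Theory.
Local Open Scope classical_set_scope.
Local Open Scope ring_scope.

Section ColoringsOfSquaredNorms.
Variables (R : realFieldType) (T : eqType) (g : R -> T).

Definition two_colored (a b d : R) :=
  ~~ constant [:: g a; g b; g d] && ~~ uniq [:: g a; g b; g d].

Hypothesis g_two_colored : forall a b d : R,
  0 < b -> a + d = b *+ 2 + 2 -> (a - d) ^+ 2 <= 16 * b -> two_colored a b d.

Lemma not_mono a b d : 0 < b -> a + d = b *+ 2 + 2 -> (a - d) ^+ 2 <= 16 * b ->
  g a = g b -> g d <> g b.
Proof.
move=> b0 e h E1 E2; have /andP[] := g_two_colored b0 e h.
by rewrite /= E1 E2 !eqxx.
Qed.

Lemma not_rainbow a b d :
    0 < b -> a + d = b *+ 2 + 2 -> (a - d) ^+ 2 <= 16 * b ->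
  g a <> g d -> g b = g a \/ g b = g d.
Proof.
move=> b0 e h /eqP nad; have /andP[_] := g_two_colored b0 e h.
rewrite /= !inE (negbTE nad) orbF !andbT negb_and !negbK (eq_sym (g a)).
by case/orP => /eqP; [left | right].
Qed.

Lemma neq_add1 b : 1 <= b -> g (b + 1) <> g b.
Proof. by move=> b1 E; apply: (@not_mono (b + 1) b (b + 1)) => //; nra. Qed.

Lemma neq_add2 b : 1 <= b -> g (b + 2) <> g b.
Proof. by move=> b1; apply: (@not_mono b b (b + 2)) => //; nra. Qed.

(** If the period failed, the four values at [b, ..., b + 3] would be distinct, and
    the color of [b + 1/2], the middle of both triples with ends [b, b + 3] and
    [b + 1, b + 2], would occur at one end of each. *)
Lemma period3 b : 1 <= b -> g (b + 3) = g b.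
Proof.
move=> b1; apply/eqP; apply/negP => /negP /eqP n30.
have n10 := neq_add1 b1; have n20 := neq_add2 b1.
have n21 : g (b + 2) <> g (b + 1).
  by rewrite (_ : b + 2 = b + 1 + 1); [apply: neq_add1; lra | lra].
have n31 : g (b + 3) <> g (b + 1).
  by rewrite (_ : b + 3 = b + 1 + 2); [apply: neq_add2; lra | lra].
have n32 : g (b + 3) <> g (b + 2).
  by rewrite (_ : b + 3 = b + 2 + 1); [apply: neq_add1; lra | lra].
have h03 : g (b + 2^-1) = g b \/ g (b + 2^-1) = g (b + 3).
  by apply: not_rainbow; [lra | lra | nra | exact: nesym].
have h12 : g (b + 2^-1) = g (b + 1) \/ g (b + 2^-1) = g (b + 2).
  by apply: not_rainbow; [lra | lra | nra | exact: nesym].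
by case: h03 h12 => -> [] E; congruence.
Qed.

Lemma periodic3 m b : 1 <= b -> g (b + 3 * m%:R) = g b.
Proof.
move=> b1; elim: m => [|m IHm]; first by rewrite mulr0 addr0.
rewrite -IHm -[RHS]period3; last by have := ler0n R m; lra.
by congr g; rewrite -natr1; ring.
Qed.

(** By periodicity, three points form a forbidden rainbow triple already when their
    defining equation holds up to a multiple of 3. *)
Lemma not_rainbow_mod3 m a b d :
    0 < b -> 1 <= d -> a + (d + 3 * m%:R) = b *+ 2 + 2 ->
    (a - (d + 3 * m%:R)) ^+ 2 <= 16 * b ->
  [\/ g b = g a, g b = g d | g a = g d].
Proof.
move=> b0 d1 e h; have [->|/eqP nad] := eqVneq (g a) (g d); first exact: Or33.
have := not_rainbow b0 e h; rewrite periodic3 //.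
by case=> // ->; [exact: Or31 | exact: Or32].
Qed.

(** A rainbow choice of [x], [y + j] and [z + k], one point from each coset of the
    integers, is contradictory.  The base point 16 is large enough for every triple
    below: their ends are less than 8 apart. *)
Lemma no_two_colored_coloring : False.
Proof.
pose x : R := 16; pose y : R := x + 3^-1; pose z : R := x + 2 / 3.
have x1 : 1 <= x by rewrite /x; lra.
have y1 : 1 <= y by rewrite /y; lra.
have z1 : 1 <= z by rewrite /z; lra.
have [j jlt nxy] : exists2 j, (j < 2)%N & g (y + j%:R) <> g x.
  have [E|/eqP n0] := eqVneq (g y) (g x); last by exists 0%N; rewrite ?addr0.
  by exists 1%N => //; rewrite -E; exact: neq_add1.
have [k klt [nxz nyz]] :
    exists2 k, (k < 3)%N & g (z + k%:R) <> g x /\ g (z + k%:R) <> g (y + j%:R).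
  have n10 : g (z + 1%:R) <> g (z + 0%:R) by rewrite addr0; exact: neq_add1.
  have n20 : g (z + 2%:R) <> g (z + 0%:R) by rewrite addr0; exact: neq_add2.
  have n21 : g (z + 2%:R) <> g (z + 1%:R).
    by rewrite (_ : z + 2%:R = z + 1%:R + 1); [apply: neq_add1; lra | lra].
  have [E0|/eqP n0] := eqVneq (g (z + 0%:R)) (g x).
    have [E1|/eqP n1] := eqVneq (g (z + 1%:R)) (g (y + j%:R)).
      by exists 2%N => //; split; congruence.
    by exists 1%N => //; split; congruence.
  have [E0|/eqP n0'] := eqVneq (g (z + 0%:R)) (g (y + j%:R)).
    have [E1|/eqP n1] := eqVneq (g (z + 1%:R)) (g x).
      by exists 2%N => //; split; congruence.
    by exists 1%N => //; split; congruence.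
  by exists 0%N.
(* The sum of the ends minus twice the middle must be 2 modulo 3, so [j + k] modulo
   3 decides which of the three points is the middle. *)
move: j k jlt klt nxy nxz nyz => [|[|//]] [|[|[|//]]] _ _ nxy nxz nyz.
- by have [||||E|E|E] := @not_rainbow_mod3 1 x (z + 0%:R) (y + 0%:R);
    [rewrite /z /y /x; lra | rewrite /z /y /x; lra | rewrite /z /y /x; lra | rewrite /z /y /x; nra | congruence|congruence|congruence].
- by have [||||E|E|E] := @not_rainbow_mod3 0 (y + 0%:R) x (z + 1%:R);
    [rewrite /z /y /x; lra | rewrite /z /y /x; lra | rewrite /z /y /x; lra | rewrite /z /y /x; nra | congruence|congruence|congruence].
- by have [||||E|E|E] := @not_rainbow_mod3 0 x (y + 0%:R) (z + 2%:R);
    [rewrite /z /y /x; lra | rewrite /z /y /x; lra | rewrite /z /y /x; lra | rewrite /z /y /x; nra | congruence|congruence|congruence].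
- by have [||||E|E|E] := @not_rainbow_mod3 0 (y + 1%:R) x (z + 0%:R);
    [rewrite /z /y /x; lra | rewrite /z /y /x; lra | rewrite /z /y /x; lra | rewrite /z /y /x; nra | congruence|congruence|congruence].
- by have [||||E|E|E] := @not_rainbow_mod3 1 x (y + 1%:R) (z + 1%:R);
    [rewrite /z /y /x; lra | rewrite /z /y /x; lra | rewrite /z /y /x; lra | rewrite /z /y /x; nra | congruence|congruence|congruence].
- by have [||||E|E|E] := @not_rainbow_mod3 2 x (z + 2%:R) (y + 1%:R);
    [rewrite /z /y /x; lra | rewrite /z /y /x; lra | rewrite /z /y /x; lra | rewrite /z /y /x; nra | congruence|congruence|congruence].
Qed.

End ColoringsOfSquaredNorms.

Section CopiesOfEll3.
Variables (R : realType) (m : nat).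

Definition plane_point (x y : R) : 'rV[R]_m.+2 := \row_i [:: x; y]`_i.

Lemma edist_plane x y x' y' :
  edist (plane_point x y) (plane_point x' y')
    = Num.sqrt ((x - x') ^+ 2 + (y - y') ^+ 2).
Proof.
rewrite /edist !big_ord_recl big1 ?addr0 => [|i _]; rewrite !mxE //=.
by rewrite nth_nil subr0 expr0n.
Qed.

Lemma edist_plane0 x y : edist (plane_point x y) 0 = Num.sqrt (x ^+ 2 + y ^+ 2).
Proof.
suff {1}-> : 0 = plane_point 0 0 by rewrite edist_plane !subr0.
by apply/rowP => i; rewrite !mxE; case: i => [[|[|[]]]].
Qed.

Lemma congruent_line x0 y0 u v : u ^+ 2 + v ^+ 2 = 1 ->
  congruent (@ell R 3)
    [set plane_point (x0 + i%:R * u) (y0 + i%:R * v) | i in [set i | (i < 3)%N]].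
Proof.
move=> uv1.
exists (fun w => plane_point (x0 + w ord0 ord0 * u) (y0 + w ord0 ord0 * v)).
split; last first.
  move=> w w' _ _; rewrite edist_plane /edist big_ord1; congr Num.sqrt.
  by rewrite -[RHS]mulr1 -uv1; ring.
rewrite /ell image_comp.
by apply: eq_imagel => i _ /=; rewrite mxE.
Qed.

(** The middle point is put at [(sqrt b, 0)]; the first coordinate [u] of the
    direction is then dictated by [d - a = 4 * sqrt b * u], and the inequality
    says that [u ^+ 2 <= 1], which leaves room for the second one. *)
Lemma ell3_with_norms (a b d : R) :
    0 < b -> a + d = b *+ 2 + 2 -> (a - d) ^+ 2 <= 16 * b ->
  exists p : nat -> 'rV[R]_m.+2,
    congruent (@ell R 3) [set p i | i in [set i | (i < 3)%N]] /\
    forall i, (i < 3)%N -> edist (p i) 0 = Num.sqrt [:: a; b; d]`_i.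
Proof.
move=> b0 e h; set s := Num.sqrt b.
have s0 : 0 < s by rewrite sqrtr_gt0.
have sE : s ^+ 2 = b by rewrite sqr_sqrtr // ltW.
pose u := (d - a) / (4 * s); pose v := Num.sqrt (1 - u ^+ 2).
have uE : 4 * s * u = d - a by rewrite /u; field; rewrite gt_eqF.
have vE : v ^+ 2 = 1 - u ^+ 2.
  rewrite sqr_sqrtr // subr_ge0 /u expr_div_n ler_pdivrMr ?exprn_gt0 ?mulr_gt0 //.
  by rewrite exprMn sE; lra.
exists (fun i => plane_point (s - u + i%:R * u) (- v + i%:R * v)); split.
  by apply: congruent_line; rewrite vE; ring.
by case=> [|[|[|//]]] _ /=; rewrite edist_plane0; congr Num.sqrt; lra.
Qed.

End CopiesOfEll3.

Lemma constant3_monochromatic (R : realType) (n r : nat) (c : 'rV[R]_n -> 'I_r)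
    (p : nat -> 'rV[R]_n) :
  constant [:: c (p 0%N); c (p 1%N); c (p 2%N)] ->
  monochromatic c [set p i | i in [set i | (i < 3)%N]].
Proof.
rewrite /= andbT => /andP[/eqP e1 /eqP e2] _ _ [i /= ilt <-] [j /= jlt <-].
by case: i ilt => [|[|[|//]]] _; case: j jlt => [|[|[|//]]] _; congruence.
Qed.

Lemma uniq3_rainbow (R : realType) (n r : nat) (c : 'rV[R]_n -> 'I_r)
    (p : nat -> 'rV[R]_n) :
  uniq [:: c (p 0%N); c (p 1%N); c (p 2%N)] ->
  rainbow c [set p i | i in [set i | (i < 3)%N]].
Proof.
rewrite /= !inE negb_or !andbT => /andP[/andP[/eqP n01 /eqP n02] /eqP n12].
move=> _ _ [i /= ilt <-] [j /= jlt <-].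
by case: i ilt => [|[|[|//]]] _; case: j jlt => [|[|[|//]]] _; congruence.
Qed.

Theorem theorem1p9 (R : realType) (r n : nat) (hr : (0 < r)%N) (hn : (2 <= n)%N)
    (c : 'rV[R]_n -> 'I_r) (hc : spherical c) :
  exists S : set 'rV[R]_n,
    congruent (@ell R 3) S /\ (monochromatic c S \/ rainbow c S).
Proof.
case: n hn c hc => [|[|m]] // _ c hc.
apply: contrapT => noS.
pose g (t : R) := c (plane_point m (Num.sqrt t) 0).
apply: (@no_two_colored_coloring R _ g) => a b d b0 e h.
have [p [pS pE]] := ell3_with_norms m b0 e h.
have cp i : (i < 3)%N -> c (p i) = g [:: a; b; d]`_i.
  move=> ilt; apply: hc; rewrite pE // edist_plane0 expr0n addr0 sqrtr_sqr.
  by rewrite ger0_norm ?sqrtr_ge0.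
rewrite /two_colored -(cp 0%N) // -(cp 1%N) // -(cp 2%N) //.
apply/andP; split; apply/negP => H; apply: noS; eexists; split; try exact: pS.
  by left; exact: constant3_monochromatic.
by right; exact: uniq3_rainbow.
Qed.
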